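(* $$\sup_{\substack{m=1,2,\ldots\\ n=m+3,m+4,\ldots\\ \mathcal{A}\in\mathbb{A}_{\mathrm{det}}^n(m)}}\ \inf_{f\in\mathbb{F}_{C^1}^n(4.086,\,17/256;\,\mathcal{A})}\ \max_{k=0,\ldots,m}\ \inf_{\boldsymbol{w}\in\mathbb{S}^n}\ \sup_{\boldsymbol{z}\in\operatorname{conv}\left(\bigcup_{\boldsymbol{y}\in\boldsymbol{x}_k+\frac18\mathbb{B}^n}\partial_{\mathrm{C}}^2 f(\boldsymbol{y})(\boldsymbol{w})\right)}\langle\boldsymbol{z},\boldsymbol{w}\rangle\ \le\ -0.0092714,$$ where $\boldsymbol{x}_0,\ldots,\boldsymbol{x}_m$ are the iterates generated by $\mathcal{A}$ when applied to (the second-order oracle that corresponds to) $f$.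
   Context: **Notation.** $\|\cdot\|$ is the Euclidean norm, $\mathbb{B}^n=\{\boldsymbol{x}\in\mathbb{R}^n:\|\boldsymbol{x}\|\le1\}$, $\mathbb{S}^n=\{\boldsymbol{x}\in\mathbb{R}^n:\|\boldsymbol{x}\|=1\}$, $\operatorname{conv}$ is the convex hull, and $\mathbb{R}^{n\times n}_{\mathrm{sym}}$ is the space of symmetric matrices. A $C^{1,1}$-function is a differentiable function $f:\mathbb{R}^n\to\mathbb{R}$ with Lipschitz continuous gradient. **Clarke generalized Hessian.** For a $C^{1,1}$-function $f:\mathbb{R}^n\to\mathbb{R}$ and $\boldsymbol{x}\in\mathbb{R}^n$, $\partial_{\mathrm{C}}^2 f(\boldsymbol{x})\subseteq\mathbb{R}^{n\times n}_{\mathrm{sym}}$ is the convex hull of the set of all limits $\lim_j\nabla^2 f(\boldsymbol{y}_j)$ along sequences $\boldsymbol{y}_j\to\boldsymbol{x}$ of points at which $f$ is twice differentiable. For $\boldsymbol{w}\in\mathbb{R}^n$, $\partial_{\mathrm{C}}^2 f(\boldsymbol{x})(\boldsymbol{w}):=\{\boldsymbol{A}\boldsymbol{w}:\boldsymbol{A}\in\partial_{\mathrm{C}}^2 f(\boldsymbol{x})\}$. **Deterministic second-order algorithms.** $\mathbb{A}_{\mathrm{det}}^n(m)$ is the set of all tuples $\mathcal{A}=(\boldsymbol{x}_0,\boldsymbol{A}_0,\ldots,\boldsymbol{A}_{m-1})$ with $\boldsymbol{x}_0\in\mathbb{R}^n$ and arbitrary (deterministic) maps $\boldsymbol{A}_k:(\mathbb{R}^n\times\mathbb{R}\times\mathbb{R}^n\times\mathbb{R}^{n\times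 n}_{\mathrm{sym}})^{k+1}\to\mathbb{R}^n$. The second-order oracle of $f$ returns $\mathcal{O}(\boldsymbol{x})=(f(\boldsymbol{x}),\nabla f(\boldsymbol{x}),\nabla^2f(\boldsymbol{x}))$ at points near which $f$ is $C^2$. The iterates generated by $\mathcal{A}$ when applied to $f$ are $\boldsymbol{x}_0$ and, recursively, $\boldsymbol{x}_{k+1}=\boldsymbol{A}_k(\boldsymbol{x}_0,\mathcal{O}(\boldsymbol{x}_0),\ldots,\boldsymbol{x}_k,\mathcal{O}(\boldsymbol{x}_k))$ for $k=0,\ldots,m-1$ (this requires $f$ to be $C^2$ near $\boldsymbol{x}_0,\ldots,\boldsymbol{x}_{m-1}$). **Function class.** For $\mathcal{A}=(\boldsymbol{x}_0,\boldsymbol{A}_0,\ldots,\boldsymbol{A}_{m-1})\in\mathbb{A}_{\mathrm{det}}^n(m)$, $\mathbb{F}_{C^1}^n(L,G;\mathcal{A})$ is the set of functions $f:\mathbb{R}^n\to\mathbb{R}$ such that: $f$ is $C^1$ and $\nabla f$ is $L$-Lipschitz continuous; $f(\boldsymbol{x}_0)-\inf_{\boldsymbol{x}\in\mathbb{R}^n}f(\boldsymbol{x})\le G$; and $f$ is $C^2$ around the iterates $\boldsymbol{x}_0,\ldots,\boldsymbol{x}_m$ generated by $\mathcal{A}$ when applied to $f$. *)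

(* Defs.v *)
From HB Require Import structures.
From mathcomp Require Import all_boot all_order all_algebra.
From mathcomp Require Import all_classical all_reals all_analysis.

Set Implicit Arguments.
Unset Strict Implicit.
Unset Printing Implicit Defensive.

Import Order.TTheory GRing.Theory Num.Theory.
Import numFieldNormedType.Exports.

Local Open Scope classical_set_scope.
Local Open Scope ring_scope.

(* R^n is 'rV[R]_n and a matrix A acts on a vector w as w *m A, which is the
   convention under which the library's 'J represents a differential.
   The library norm `|x| on 'rV[R]_n is the sup norm, so the Euclidean one is
   defined here; both induce the same topology, hence limits, continuity and
   differentiability are those of the library. *)

Definition dotv (R : realType) (n : nat) (u v : 'rV[R]_n) : R :=
  \sum_(i < n) u 0 i * v 0 i.

Definition enorm (R : realType) (n : nat) (u : 'rV[R]_n) : R :=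
  Num.sqrt (dotv u u).

Definition euclidean_ball (R : realType) (n : nat) : set 'rV[R]_n :=
  [set u | enorm u <= 1].

Definition euclidean_sphere (R : realType) (n : nat) : set 'rV[R]_n :=
  [set u | enorm u = 1].

Definition convex_hull (R : realType) (V : lmodType R) (S : set V) : set V :=
  smallest (@convex_set R V) S.

Definition grad (R : realType) (n : nat) (f : 'rV[R]_n -> R) (x : 'rV[R]_n) :
    'rV[R]_n :=
  \row_(i < n) 'D_(delta_mx 0 i) f x.

Definition hess (R : realType) (n : nat) (f : 'rV[R]_n -> R) (x : 'rV[R]_n) :
    'M[R]_n :=
  'J (grad f) x.

Definition twice_differentiable (R : realType) (n : nat) (f : 'rV[R]_n -> R)
    (x : 'rV[R]_n) : Prop :=
  (\forall y \near x, differentiable f y) /\ differentiable (grad f) x.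

Definition C1_function (R : realType) (n : nat) (f : 'rV[R]_n -> R) : Prop :=
  (forall x, differentiable f x) /\ continuous (grad f).

Definition C2_around (R : realType) (n : nat) (f : 'rV[R]_n -> R)
    (x : 'rV[R]_n) : Prop :=
  \forall y \near x, twice_differentiable f y /\ {for y, continuous (hess f)}.

Definition clarke_hessian (R : realType) (n : nat) (f : 'rV[R]_n -> R)
    (x : 'rV[R]_n) : set 'M[R]_n :=
  convex_hull [set A : 'M[R]_n | exists y : nat -> 'rV[R]_n,
    [/\ forall j, twice_differentiable f (y j),
        y j @[j --> \oo] --> x &
        hess f (y j) @[j --> \oo] --> A]].

Definition clarke_hessian_at (R : realType) (n : nat) (f : 'rV[R]_n -> R)
    (x w : 'rV[R]_n) : set 'rV[R]_n :=
  [set w *m A | A in clarke_hessian f x].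

Definition symmx (R : realType) (n : nat) : Type :=
  {A : 'M[R]_n | A^T == A}.

Lemma symmx0_subproof (R : realType) (n : nat) : (0 : 'M[R]_n)^T == 0.
Proof. by rewrite trmx0. Qed.

Definition symmx0 (R : realType) (n : nat) : symmx R n :=
  exist _ 0 (symmx0_subproof R n).

(* The last component is the Hessian whenever the Hessian is symmetric, in
   particular at every point around which f is C^2; only such points are queried
   for functions of the class below. The value 0 elsewhere is a dummy. *)
Definition oracle (R : realType) (n : nat) (f : 'rV[R]_n -> R) (x : 'rV[R]_n) :
    R * 'rV[R]_n * symmx R n :=
  (f x, grad f x, insubd (symmx0 R n) (hess f x)).

Record det_algorithm (R : realType) (n m : nat) := DetAlgorithm {
  start : 'rV[R]_n;
  step : forall k : 'I_m,
    k.+1.-tuple ('rV[R]_n * (R * 'rV[R]_n * symmx R n)) -> 'rV[R]_n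
}.

(* The iterates x_0, ..., x_k, built recursively as x_{j+1} is computed from all
   of its predecessors and their oracle values. *)
Fixpoint first_iterates (R : realType) (n m : nat) (A : det_algorithm R n m)
    (f : 'rV[R]_n -> R) (k : nat) : (k <= m)%N -> k.+1.-tuple 'rV[R]_n :=
  match k with
  | 0 => fun _ => [tuple start A]
  | j.+1 => fun jm =>
      let xs := first_iterates A f (ltnW jm) in
      [tuple of rcons xs
        (@step R n m A (Ordinal jm) [tuple of [seq (x, oracle f x) | x <- xs]])]
  end.

Definition iterates (R : realType) (n m : nat) (A : det_algorithm R n m)
    (f : 'rV[R]_n -> R) (k : 'I_m.+1) : 'rV[R]_n :=
  tnth (first_iterates A f (leqnn m)) k.

(* The optimality gap is an extended real, so that it is +oo when f is not
   bounded below. *)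
Definition F_C1 (R : realType) (n m : nat) (L G : R)
    (A : det_algorithm R n m) : set ('rV[R]_n -> R) :=
  [set f | [/\ C1_function f,
               forall x y, enorm (grad f x - grad f y) <= L * enorm (x - y),
               ((f (start A))%:E - ereal_inf [set (f x)%:E | x in setT]
                 <= G%:E)%E &
               forall k : 'I_m.+1, C2_around f (iterates A f k)]].

Definition stationarity (R : realType) (n : nat) (r : R)
    (f : 'rV[R]_n -> R) (x : 'rV[R]_n) : \bar R :=
  ereal_inf [set
    ereal_sup [set (dotv z w)%:E | z in
      convex_hull (\bigcup_(y in [set x + r *: u | u in @euclidean_ball R n])
              clarke_hessian_at f y w)]
    | w in @euclidean_sphere R n].

(* Main.v *)
From HB Require Import structures.
Require Import Defs.
From mathcomp Require Import all_boot all_order all_algebra.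
From mathcomp Require Import all_classical all_reals all_analysis.
From mathcomp Require Import ring lra.
Set Implicit Arguments.
Unset Strict Implicit.
Unset Printing Implicit Defensive.

Import Order.TTheory GRing.Theory Num.Theory.
Import numFieldNormedType.Exports.
Local Open Scope classical_set_scope.
Local Open Scope ring_scope.

(** The theorem is witnessed by a resisting oracle that answers every query with
    the same triple: value [0], gradient [0], Hessian [- 1/10] times the
    identity.  Against these answers a deterministic algorithm produces a fixed
    list of at most [m + 1] points [p] ([blind_iterates]), and it remains to
    find a function of the class that gives these answers at all of them; the
    iterates on that function are then the blind ones ([first_iterates_blind]).

    Since [n > m + 1], some unit vector [e] is orthogonal to all differences
    [p - x0] ([unit_orthogonal]).  Write [Q] for the projection on [e] and
    [P = 1 - Q].  The hard function is separable along this splitting: up to a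
    constant it is a tenth of
      [bump_{1/16} (Q (x - x0)) + sum_p bump_r (P (x - p))],
    where [bump_r y] equals [3 r / 4 - |y|^2 / 2] for [|y|^2 <= r], vanishes for
    [|y|^2 >= 2 r], is nonnegative and has a 9-Lipschitz gradient whatever [r].
    With [r] so small that the patches are disjoint, the function is
    [- |x - p|^2 / 20] near each [p], which is the announced answer.

    The point is that the patches depend on [P x] only, so they do not bend the
    function along [e]: in the whole slab [|<x - x0, e>| <= 1/4] its slope along
    [e] is [- <x - x0, e> / 10].  Each ball of radius 1/8 about an iterate lies
    inside that slab, hence every Clarke Hessian [H] met there satisfies
    [<e, H e> = - 1/10], and the direction [w = e] bounds the stationarity
    measure at all iterates ([hard_stationarity]).  The constants leave room:
    the gradient is Lipschitz with constant [(9 + 18) / 10], the optimality gap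
    is at most 3/320, and the curvature [- 1/10] is below [- 0.0092714].

    First and second derivatives are never computed by differentiation rules.
    Gradients come from explicit fields with a quadratic remainder
    ([quad_remainder]), and the only Hessian values used are those of exactly
    affine gradients ([hess_affine]) and those along the direction [e]
    ([hess_curvature]), so that bumps of class [C^{1,1}] suffice. *)

(** * Euclidean geometry of row vectors *)

Section Euclidean.
Context {R : realType} {n : nat}.
Implicit Types (u v w : 'rV[R]_n) (M : 'M[R]_n).

Lemma dotvE u v : dotv u v = (u *m v^T) 0 0.
Proof. by rewrite mxE; apply: eq_bigr => i _; rewrite mxE. Qed.

Lemma dotvC u v : dotv u v = dotv v u.
Proof. by apply: eq_bigr => i _; rewrite mulrC. Qed.

Lemma dotvDl u v w : dotv (u + v) w = dotv u w + dotv v w.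
Proof. by rewrite !dotvE mulmxDl mxE. Qed.

Lemma dotvDr u v w : dotv u (v + w) = dotv u v + dotv u w.
Proof. by rewrite dotvC dotvDl !(dotvC _ u). Qed.

Lemma dotvZl (a : R) u v : dotv (a *: u) v = a * dotv u v.
Proof. by rewrite !dotvE -scalemxAl mxE. Qed.

Lemma dotvZr (a : R) u v : dotv u (a *: v) = a * dotv u v.
Proof. by rewrite dotvC dotvZl dotvC. Qed.

Lemma dotvNl u v : dotv (- u) v = - dotv u v.
Proof. by rewrite -scaleN1r dotvZl mulN1r. Qed.

Lemma dotvNr u v : dotv u (- v) = - dotv u v.
Proof. by rewrite dotvC dotvNl dotvC. Qed.

Lemma dotv0l v : dotv 0 v = 0.
Proof. by rewrite -(scale0r 0) dotvZl mul0r. Qed.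

(** Expands inner products by bilinearity. *)
Definition dotvlin := (dotvDl, dotvDr, dotvZl, dotvZr, dotvNl, dotvNr).

Lemma dotv_suml (I : Type) (r : seq I) (F : I -> 'rV[R]_n) v :
  dotv (\sum_(i <- r) F i) v = \sum_(i <- r) dotv (F i) v.
Proof.
elim: r => [|i r IH]; first by rewrite !big_nil dotv0l.
by rewrite !big_cons dotvDl IH.
Qed.

Lemma dotv_mulmx u v M : dotv (u *m M) v = dotv u (v *m M^T).
Proof. by rewrite !dotvE trmx_mul trmxK mulmxA. Qed.

Lemma dotvv_ge0 u : 0 <= dotv u u.
Proof. by apply: sumr_ge0 => i _; rewrite -expr2 sqr_ge0. Qed.

Lemma dotvv_eq0 u : (dotv u u == 0) = (u == 0).
Proof.
apply/eqP/eqP => [u0|->]; last exact: dotv0l.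
apply/rowP => i; rewrite mxE; apply/eqP; rewrite -sqrf_eq0 expr2.
have /psumr_eq0P : dotv u u = 0 by [].
by move=> /(_ (fun i _ => ltac:(by rewrite -expr2 sqr_ge0))) ->.
Qed.

Lemma cauchy_schwarz u v : dotv u v ^+ 2 <= dotv u u * dotv v v.
Proof.
have [->|v0] := eqVneq v 0.
  by rewrite dotvC !dotv0l mulr0 expr0n.
have vv : 0 < dotv v v by rewrite lt_neqAle eq_sym dotvv_eq0 v0 dotvv_ge0.
have := dotvv_ge0 (dotv v v *: u - dotv u v *: v).
rewrite !dotvlin (dotvC v u).
set a := dotv v v in vv *; set b := dotv u v; set c := dotv u u => H.
have {H} : 0 <= a * (c * a - b ^+ 2) by move: H; congr (0 <= _); ring.
by rewrite pmulr_rge0// subr_ge0.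
Qed.

Lemma enorm_ge0 u : 0 <= enorm u.
Proof. exact: sqrtr_ge0. Qed.

Lemma enorm_sqr u : enorm u ^+ 2 = dotv u u.
Proof. by rewrite sqr_sqrtr// dotvv_ge0. Qed.

Lemma enorm0 : enorm (0 : 'rV[R]_n) = 0.
Proof. by rewrite /enorm dotv0l sqrtr0. Qed.

Lemma enormZ (a : R) u : enorm (a *: u) = `|a| * enorm u.
Proof.
by rewrite /enorm dotvZl dotvZr mulrA -expr2 sqrtrM ?sqr_ge0// sqrtr_sqr.
Qed.

Lemma enormN u : enorm (- u) = enorm u.
Proof. by rewrite -scaleN1r enormZ normrN normr1 mul1r. Qed.

Lemma enorm_distC u v : enorm (u - v) = enorm (v - u).
Proof. by rewrite -enormN opprB. Qed.

Lemma enorm_le u (c : R) : 0 <= c -> dotv u u <= c ^+ 2 -> enorm u <= c.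
Proof.
by move=> c0 H; rewrite -(ger0_norm c0) -sqrtr_sqr; apply: ler_wsqrtr.
Qed.

Lemma dotv_le_enorm u v : `|dotv u v| <= enorm u * enorm v.
Proof.
rewrite -sqrtr_sqr -sqrtrM ?dotvv_ge0//.
by apply: ler_wsqrtr; exact: cauchy_schwarz.
Qed.

Lemma enormD u v : enorm (u + v) <= enorm u + enorm v.
Proof.
apply: enorm_le; first by rewrite addr_ge0 ?enorm_ge0.
rewrite !dotvlin (dotvC v u) sqrrD !enorm_sqr.
have := le_trans (ler_norm _) (dotv_le_enorm u v).
by move=> ?; rewrite mulr2n; lra.
Qed.

Lemma enormB u v : enorm (u - v) <= enorm u + enorm v.
Proof. by rewrite -(enormN v) enormD. Qed.

Lemma enorm_dist u v : enorm u - enorm v <= enorm (u - v).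
Proof. by rewrite lerBlDr (le_trans _ (enormD _ _))// subrK. Qed.

(** The topology on row vectors comes from the sup norm, which the two
    inequalities below compare with the Euclidean norm. *)
Lemma normr_le_enorm u : `|u| <= enorm u.
Proof.
rewrite [leLHS]mx_normrE; apply: bigmax_le => [|[i j] _ /=]; first exact: enorm_ge0.
rewrite ord1 -sqrtr_sqr; apply: ler_wsqrtr.
rewrite /dotv (bigD1 j)//= expr2 lerDl.
by apply: sumr_ge0 => k _; rewrite -expr2 sqr_ge0.
Qed.

Lemma dotvv_le_normr u : dotv u u <= n%:R * `|u| ^+ 2.
Proof.
have -> : n%:R * `|u| ^+ 2 = \sum_(i < n) `|u| ^+ 2.
  by rewrite sumr_const card_ord mulr_natl.
apply: ler_sum => i _; rewrite -expr2 -real_normK ?num_real//.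
rewrite lerXn2r ?nnegrE// [leRHS]mx_normrE.
exact: (le_bigmax _ (fun ij => `|u ij.1 ij.2|) (0, i)).
Qed.

End Euclidean.

(** * Differentiability from a quadratic remainder *)

Section QuadraticRemainder.
Context {R : realType} {n : nat}.

Let addR_continuous : continuous (fun z : R * R => z.1 + z.2).
Proof. exact: add_continuous. Qed.

Lemma continuous_dotvr (v : 'rV[R]_n) : continuous (fun u : 'rV[R]_n => dotv u v).
Proof.
rewrite /dotv; apply: (continuous_big addR_continuous) => i _.
by move=> u; apply: (@cvgMr_tmp _ _ (nbhs u)); exact: (@coord_continuous R 1 n 0 i u).
Qed.

Lemma continuous_quadform (v : 'rV[R]_n) :
  continuous (fun A : 'M[R]_n => dotv (v *m A) v).
Proof.
rewrite /dotv; apply: (continuous_big addR_continuous) => i _.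
move=> A; apply: (@cvgMr_tmp _ _ (nbhs A)).
under eq_fun do rewrite mxE.
rewrite mxE; apply: (cvg_big addR_continuous) => j _.
by apply: (@cvgMl_tmp _ _ (nbhs A)); exact: (@coord_continuous R n n j i A).
Qed.

(** The differential is defined by choice; this packages its uniqueness so that a
    linear map with small remainder yields both differentiability and the value
    of the differential. *)
Lemma diff_littleo (V W : normedModType R) (f : V -> W) (df : {linear V -> W})
    (x : V) : continuous df ->
  (forall e : R, 0 < e ->
     \forall h \near 0, `|f (h + x) - f x - df h| <= e * `|h|) ->
  differentiable f x /\ 'd f x = df :> (V -> W).
Proof.
move=> dfc fdf.
have fo : f \o shift x = cst (f x) + df +o_ 0 id.
  apply/eqaddoP => e e0; near=> h.
  rewrite /= !fctE opprD addrA; near: h; exact: fdf.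
have E := diff_unique dfc fo.
split => //; apply/diff_locallyP; split; first by rewrite E.
by rewrite E.
Unshelve. all: by end_near. Qed.

End QuadraticRemainder.

(** A constant of its own, because a linear structure needs a head symbol. *)
Definition dotvr {R : realType} {n : nat} (w u : 'rV[R]_n) : R := dotv u w.

Lemma dotvr_linear {R : realType} {n : nat} (w : 'rV[R]_n) : linear (dotvr w).
Proof. by move=> a u v; rewrite /dotvr dotvDl dotvZl. Qed.

HB.instance Definition _ (R : realType) (n : nat) (w : 'rV[R]_n) :=
  GRing.isLinear.Build R 'rV[R]_n R _ (dotvr w) (dotvr_linear w).

(** The constant may depend on the base point and the remainder is required for
    increments in the unit ball only, because the bumps below are quartic in
    places.  This notion is stable under sums, scaling and projections, and it
    implies differentiability with gradient [g]. *)
Definition quad_remainder {R : realType} {n : nat} (f : 'rV[R]_n -> R)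
    (g : 'rV[R]_n -> 'rV[R]_n) : Prop :=
  forall x, exists C, forall v, dotv v v <= 1 ->
    `|f (v + x) - f x - dotv (g x) v| <= C * dotv v v.

Section Remainder.
Context {R : realType} {n : nat}.
Implicit Types (f : 'rV[R]_n -> R) (g : 'rV[R]_n -> 'rV[R]_n).

Lemma quad_remainder_diff f g x : quad_remainder f g ->
  differentiable f x /\ grad f x = g x.
Proof.
move=> /(_ x)[C fC].
have n1 : 0 < n%:R + 1 :> R by rewrite ltr_wpDl.
have [||df dfE] := @diff_littleo R _ _ f (dotvr (g x)) x.
- exact: continuous_dotvr.
- move=> e e0.
  have C1 : 0 < `|C| + 1 by rewrite ltr_wpDl.
  (* the first bound keeps the increment in the Euclidean unit ball, the second
     absorbs the quadratic remainder into [e * `|h|] *)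
  have d0 : 0 < Num.min (n%:R + 1)^-1 (e / ((n%:R + 1) * (`|C| + 1))).
    by rewrite lt_min invr_gt0 n1 divr_gt0// mulr_gt0.
  near=> h.
  have : `|h| <= Num.min (n%:R + 1)^-1 (e / ((n%:R + 1) * (`|C| + 1))).
    by near: h; exact: (@nbhs0_le R 'rV[R]_n _ d0).
  rewrite le_min => /andP[].
  rewrite ler_pdivlMr ?mulr_gt0// -[_^-1]mul1r ler_pdivlMr// => h1 h2.
  have hh := dotvv_le_normr h; have h0 := normr_ge0 h.
  have n0 : 0 <= n%:R :> R by [].
  set N := n%:R in hh h1 h2 n0; set t := `|h| in hh h1 h2 h0 *.
  have hle : dotv h h <= (N + 1) * t * t.
    by rewrite (le_trans hh)// expr2 -mulrA ler_wpM2r ?mulr_ge0// lerDl.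
  have t1 : t <= 1 by nra.
  have dh1 : dotv h h <= 1.
    by rewrite (le_trans hle)// (le_trans _ t1)// ler_piMl// mulrC.
  have fCh : `|f (h + x) - f x - dotv h (g x)| <= C * dotv h h.
    by rewrite (dotvC h); exact: fC.
  apply: (le_trans fCh); apply: (@le_trans _ _ ((`|C| + 1) * dotv h h)).
    by rewrite ler_wpM2r ?dotvv_ge0// (le_trans (ler_norm _))// lerDl.
  apply: (le_trans (ler_wpM2l (ltW C1) hle)); rewrite mulrA ler_wpM2r//.
  by rewrite mulrC -(mulrC t) -mulrA.
split => //; apply/rowP => i; rewrite mxE deriveE// dfE /= /dotvr /dotv.
rewrite (bigD1 i)//= big1 ?addr0; first by rewrite mxE !eqxx mul1r.
by move=> j ji; rewrite mxE (negPf ji) andbF mul0r.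
Unshelve. all: by end_near. Qed.

Lemma quad_remainder_cst (c : R) : quad_remainder (fun=> c) (fun=> 0 : 'rV[R]_n).
Proof. by move=> x; exists 0 => v _; rewrite dotv0l mul0r subrr subr0 normr0. Qed.

Lemma quad_remainderD f1 g1 f2 g2 :
  quad_remainder f1 g1 -> quad_remainder f2 g2 ->
  quad_remainder (fun x => f1 x + f2 x) (fun x => g1 x + g2 x).
Proof.
move=> h1 h2 x; have [C1 {}h1] := h1 x; have [C2 {}h2] := h2 x.
exists (C1 + C2) => v v1; rewrite mulrDl.
apply: le_trans (lerD (h1 _ v1) (h2 _ v1)).
apply: le_trans (ler_normD _ _).
by rewrite dotvDl le_eqVlt; apply/orP; left; apply/eqP; congr `|_|; ring.
Qed.

Lemma quad_remainderZ (a : R) f g : quad_remainder f g ->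
  quad_remainder (fun x => a * f x) (fun x => a *: g x).
Proof.
move=> h x; have [C {}h] := h x; exists (`|a| * C) => v v1.
by rewrite dotvZl -!mulrBr normrM -mulrA ler_wpM2l// h.
Qed.

Lemma quad_remainder_sum (I : Type) (s : seq I) (f : I -> 'rV[R]_n -> R)
    (g : I -> 'rV[R]_n -> 'rV[R]_n) :
  (forall i, quad_remainder (f i) (g i)) ->
  quad_remainder (fun x => \sum_(i <- s) f i x) (fun x => \sum_(i <- s) g i x).
Proof.
move=> fg; elim: s => [|i s IH] x.
  have [C fC] := @quad_remainder_cst 0 x.
  by exists C => v /fC; rewrite !big_nil.
have [C fC] := quad_remainderD (fg i) IH x.
by exists C => v /fC; rewrite !big_cons.
Qed.

(** By the chain rule, the gradient of [f ((x - p) *m M)] carries an extra factor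
    [M^T], which is [M] for the orthogonal projections used below. *)
Lemma quad_remainder_affine f g (p : 'rV[R]_n) (M : 'M[R]_n) :
  M^T = M -> (forall v, dotv (v *m M) (v *m M) <= dotv v v) ->
  quad_remainder f g ->
  quad_remainder (fun x => f ((x - p) *m M)) (fun x => g ((x - p) *m M) *m M).
Proof.
move=> MT Mle h x; have [C {}h] := h ((x - p) *m M).
exists `|C| => v v1; rewrite dotv_mulmx MT.
have -> : (v + x - p) *m M = v *m M + (x - p) *m M by rewrite -addrA mulmxDl.
apply: (le_trans (h _ (le_trans (Mle _) v1))).
apply: (@le_trans _ _ (`|C| * dotv (v *m M) (v *m M))).
  by rewrite ler_wpM2r ?dotvv_ge0// ler_norm.
by rewrite ler_wpM2l.
Qed.

End Remainder.

(** * Bumps that are exactly quadratic near their centre *)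

Section Bump.
Context {R : realType} {n : nat}.
Implicit Types (u v y : 'rV[R]_n) (r t : R).

Definition pos t : R := Num.max 0 t.

Lemma pos_ge0 t : 0 <= pos t.
Proof. by rewrite /pos le_max lexx. Qed.

Lemma pos_id t : 0 <= t -> pos t = t.
Proof. by move=> t0; rewrite /pos max_r. Qed.

Lemma pos_eq0 t : t <= 0 -> pos t = 0.
Proof. by move=> t0; rewrite /pos max_l. Qed.

(** The square of the positive part is [C^{1,1}] with derivative [2 * pos]; the
    remainder is controlled uniformly across the kink at zero. *)
Lemma pos_sqr_remainder t d :
  `|pos (t + d) ^+ 2 - pos t ^+ 2 - 2 * pos t * d| <= d ^+ 2.
Proof.
have [t0|t0] := leP 0 t; have [td|td] := leP 0 (t + d);
  rewrite ?(pos_id t0) ?(pos_eq0 (ltW t0)) ?(pos_id td) ?(pos_eq0 (ltW td));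
  rewrite ler_norml; apply/andP; split; nra.
Qed.

Definition well r y : R := pos (r - dotv y y) ^+ 2.

Definition well_field r y : 'rV[R]_n := pos (r - dotv y y) *: y.

Lemma well_remainder r :
  quad_remainder (well r) (fun y => -4 *: well_field r y).
Proof.
move=> y; exists (8 * dotv y y + 2 + 2 * pos (r - dotv y y)) => v v1.
have := pos_sqr_remainder (r - dotv y y) (- (2 * dotv y v + dotv v v)).
have -> : r - dotv y y + - (2 * dotv y v + dotv v v) = r - dotv (v + y) (v + y).
  by rewrite !dotvlin (dotvC v y); ring.
rewrite /well /well_field !dotvZl.
set a := pos (r - dotv (v + y) (v + y)); set b := pos (r - dotv y y) => H.
have b0 : 0 <= b := pos_ge0 _.
have := cauchy_schwarz y v; have := dotvv_ge0 v; have := dotvv_ge0 y.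
move: v1 H; set q := dotv v v; set p := dotv y v; set c := dotv y y.
move=> q1 H c0 q0 cs.
have q2 : q * q <= q by rewrite ler_piMl.
have dd : (- (2 * p + q)) ^+ 2 <= (8 * c + 2) * q.
  have : 0 <= (2 * p - q) ^+ 2 by exact: sqr_ge0.
  by nra.
have bq : 0 <= b * q by rewrite mulr_ge0.
move: H; rewrite !ler_norml => /andP[H1 H2].
by apply/andP; split; nra.
Qed.

(** The Lipschitz constant scales like [r].  If both points lie in the ball of
    squared radius [r], split the difference into a change of position and a
    change of weight; if one lies outside, where the field vanishes, factor
    [r - |u|^2] through the radius [sqrt r], which separates the two norms. *)
Lemma well_field_lipschitz r u v : 0 <= r ->
  enorm (well_field r u - well_field r v) <= 3 * r * enorm (u - v).
Proof.
move=> r0.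
wlog uv : u v / enorm u <= enorm v => [hw|].
  have [|/ltW] := leP (enorm u) (enorm v); first exact: hw.
  by move=> /hw; rewrite enorm_distC (enorm_distC v).
have d0 := enorm_ge0 (u - v); have u0 := enorm_ge0 u; have v0 := enorm_ge0 v.
have vud := enorm_dist v u; rewrite (enorm_distC v u) in vud.
have Eu := enorm_sqr u; have Ev := enorm_sqr v.
rewrite /well_field -Eu -Ev.
have [rv|rv] := leP (enorm v ^+ 2) r.
  have ru : enorm u ^+ 2 <= r by rewrite (le_trans _ rv)// lerXn2r.
  rewrite !pos_id ?subr_ge0//.
  have -> : (r - enorm u ^+ 2) *: u - (r - enorm v ^+ 2) *: v =
    (r - enorm u ^+ 2) *: (u - v) + (enorm v ^+ 2 - enorm u ^+ 2) *: v.
    by apply/rowP => i; rewrite !mxE; ring.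
  apply: (le_trans (enormD _ _)); rewrite !enormZ.
  rewrite !ger0_norm ?subr_ge0//; last by rewrite lerXn2r.
  move: rv ru uv d0 u0 v0 vud; set d := enorm (u - v); set a := enorm u.
  set b := enorm v; rewrite !expr2 => rv ru uv d0 u0 v0 vud.
  have ab : (b * b - a * a) * b <= 2 * r * d.
    have -> : (b * b - a * a) * b = (b - a) * ((b + a) * b) by ring.
    have : (b + a) * b <= 2 * r by nra.
    have : 0 <= (b + a) * b by nra.
    by nra.
  by nra.
rewrite (pos_eq0 (t := r - enorm v ^+ 2)) ?subr_le0 ?(ltW rv)// scale0r subr0.
have [ru|ru] := leP (enorm u ^+ 2) r; last first.
  by rewrite pos_eq0 ?subr_le0 ?(ltW ru)// scale0r enorm0 !mulr_ge0.
rewrite pos_id ?subr_ge0// enormZ ger0_norm ?subr_ge0//.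
move: rv ru uv d0 u0 v0 vud; set d := enorm (u - v); set a := enorm u.
set b := enorm v; rewrite !expr2 => rv ru uv d0 u0 v0 vud.
pose s := Num.sqrt r.
have s0 : 0 <= s := sqrtr_ge0 _.
have sr : s * s = r by rewrite -expr2 sqr_sqrtr.
have as_ : a <= s by rewrite -ler_sqr ?nnegrE// !expr2 sr.
have sb : s <= b by rewrite -ler_sqr ?nnegrE// !expr2 sr ltW.
rewrite -sr.
have -> : (s * s - a * a) * a = (s - a) * ((s + a) * a) by ring.
have h1 : (s + a) * a <= 2 * (s * s) by nra.
have h0 : 0 <= (s + a) * a by nra.
have h2 : s - a <= d by lra.
have h3 : 0 <= s - a by lra.
by have := ler_pM h3 h0 h2 h1; nra.
Qed.

(** The difference of two truncated quartics in which the terms of degree four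
    cancel inside the smaller ball: there the bump is exactly quadratic with
    curvature [-1], while it still vanishes outside the larger ball. *)
Definition bump r y : R := (4 * r)^-1 * (well (2 * r) y - well r y).

Definition bump_grad r y : 'rV[R]_n :=
  - r^-1 *: (well_field (2 * r) y - well_field r y).

Lemma bump_remainder r : 0 < r -> quad_remainder (bump r) (bump_grad r).
Proof.
move=> r0.
have := quad_remainderZ (4 * r)^-1 (quad_remainderD (well_remainder (2 * r))
  (quad_remainderZ (-1) (well_remainder r))).
congr quad_remainder; apply/funext => y; rewrite /bump /bump_grad ?mulN1r//.
by apply/rowP => i; rewrite !mxE; field; rewrite gt_eqF.
Qed.

(** The bound does not depend on [r], so patches may be shrunk freely:
    [3 * (2 * r) + 3 * r], divided by [r]. *)
Lemma bump_grad_lipschitz r u v : 0 < r ->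
  enorm (bump_grad r u - bump_grad r v) <= 9 * enorm (u - v).
Proof.
move=> r0; rewrite /bump_grad -scalerBr enormZ normrN ger0_norm ?invr_ge0 ?(ltW r0)//.
rewrite ler_pdivrMl//.
have -> : well_field (2 * r) u - well_field r u -
          (well_field (2 * r) v - well_field r v) =
  (well_field (2 * r) u - well_field (2 * r) v) -
  (well_field r u - well_field r v).
  by apply/rowP => i; rewrite !mxE; ring.
apply: (le_trans (enormB _ _)).
have r2 : 0 <= 2 * r by rewrite mulr_ge0// ltW.
have := well_field_lipschitz u v r2; have := well_field_lipschitz u v (ltW r0).
by lra.
Qed.

Lemma bump_ge0 r y : 0 < r -> 0 <= bump r y.
Proof.
move=> r0; apply: mulr_ge0; first by rewrite invr_ge0 mulr_ge0// ltW.
rewrite subr_ge0 /well.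
rewrite lerXn2r ?nnegrE ?pos_ge0// /pos ge_max !le_max lexx/=.
by apply/orP; right; lra.
Qed.

Lemma bump_near r y : 0 < r -> dotv y y <= r ->
  bump r y = 3 * r / 4 - dotv y y / 2.
Proof.
move=> r0 yr; rewrite /bump /well !pos_id; [|lra|lra].
by field; rewrite gt_eqF.
Qed.

Lemma bump_grad_near r y : 0 < r -> dotv y y <= r -> bump_grad r y = - y.
Proof.
move=> r0 yr; rewrite /bump_grad /well_field !pos_id; [|lra|lra].
by apply/rowP => i; rewrite !mxE; field; rewrite gt_eqF.
Qed.

Lemma bump_far r y : 0 < r -> 2 * r <= dotv y y -> bump r y = 0.
Proof.
by move=> r0 yr; rewrite /bump /well !pos_eq0 ?subrr ?mulr0//; lra.
Qed.

Lemma bump_grad_far r y : 0 < r -> 2 * r <= dotv y y -> bump_grad r y = 0.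
Proof.
by move=> r0 yr; rewrite /bump_grad /well_field !pos_eq0 ?scale0r ?subrr ?scaler0//;
  lra.
Qed.

End Bump.

(** * Splitting off a direction *)

Section Axis.
Context {R : realType} {n : nat}.
Implicit Types (e v : 'rV[R]_n).

Definition axis e : 'M[R]_n := e^T *m e.

Definition coaxis e : 'M[R]_n := 1%:M - axis e.

Lemma tr_axis e : (axis e)^T = axis e.
Proof. by rewrite /axis trmx_mul trmxK. Qed.

Lemma tr_coaxis e : (coaxis e)^T = coaxis e.
Proof. by rewrite /coaxis linearB /= trmx1 tr_axis. Qed.

Lemma mul_axis e v : v *m axis e = dotv v e *: e.
Proof.
rewrite /axis mulmxA [v *m e^T]mx11_scalar mul_scalar_mx.
by rewrite dotvE.
Qed.

Lemma mul_coaxis e v : v *m coaxis e = v - dotv v e *: e.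
Proof. by rewrite /coaxis mulmxBr mulmx1 mul_axis. Qed.

Lemma axis_coaxis e v : v *m axis e + v *m coaxis e = v.
Proof. by rewrite mul_axis mul_coaxis addrC subrK. Qed.

Lemma mul_axis_axis e v : dotv e e = 1 -> v *m axis e *m axis e = v *m axis e.
Proof. by move=> e1; rewrite !mul_axis dotvZl e1 mulr1. Qed.

Lemma mul_coaxis_coaxis e v : dotv e e = 1 ->
  v *m coaxis e *m coaxis e = v *m coaxis e.
Proof.
move=> e1; rewrite !mul_coaxis !dotvlin e1 mulr1 subrr.
by rewrite scale0r subr0.
Qed.

Lemma coaxis_contraction e v : dotv e e = 1 ->
  dotv (v *m coaxis e) (v *m coaxis e) <= dotv v v.
Proof.
move=> e1; rewrite mul_coaxis !dotvlin e1 (dotvC e).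
by have := sqr_ge0 (dotv v e); lra.
Qed.

Lemma axis_contraction e v : dotv e e = 1 ->
  dotv (v *m axis e) (v *m axis e) <= dotv v v.
Proof.
move=> e1; rewrite mul_axis !dotvlin e1 mulr1 -expr2.
by have := cauchy_schwarz v e; rewrite e1 mulr1.
Qed.

End Axis.

Lemma enorm_contraction {R : realType} {n : nat} (u v : 'rV[R]_n) :
  dotv u u <= dotv v v -> enorm u <= enorm v.
Proof. exact: ler_wsqrtr. Qed.

(** * The hard function *)

(** Only the field active at [u] and the one active at [v] contribute to the
    difference, and each of them vanishes at the other point; the factor 2
    therefore does not grow with the number of fields. *)
Lemma disjoint_sum_lipschitz {R : realType} {n : nat} (I : eqType)
    (s : seq I) (c : R) (F : I -> 'rV[R]_n -> 'rV[R]_n) : uniq s -> 0 <= c ->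
  (forall i u v, enorm (F i u - F i v) <= c * enorm (u - v)) ->
  (forall u i j, i \in s -> j \in s -> i != j -> F i u = 0 \/ F j u = 0) ->
  forall u v, enorm (\sum_(i <- s) F i u - \sum_(i <- s) F i v) <=
              2 * c * enorm (u - v).
Proof.
move=> us c0 Flip Fdisj u v.
have duv : 0 <= c * enorm (u - v) by rewrite mulr_ge0 ?enorm_ge0.
case: s => [|i0 s0] in us Fdisj *.
  by rewrite !big_nil subr0 enorm0 -mulrA mulr_ge0.
set s := i0 :: s0 in us Fdisj *.
have active x : exists2 i, i \in s & forall j, j \in s -> j != i -> F j x = 0.
  have [/hasP[i si Fi]|/hasPn F0] := boolP (has (fun i => F i x != 0) s).
    exists i => // j sj ji; case: (Fdisj x j i sj si ji) => // Fi0.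
    by rewrite Fi0 eqxx in Fi.
  exists i0; first exact: mem_head.
  by move=> j /F0; rewrite negbK => /eqP.
have sumE x i : i \in s -> (forall j, j \in s -> j != i -> F j x = 0) ->
    \sum_(j <- s) F j x = F i x.
  move=> si Fi; rewrite (bigD1_seq i)//= big1_seq ?addr0// => j /andP[ji sj].
  exact: Fi.
have [i si Fi] := active u; have [j sj Fj] := active v.
rewrite (sumE _ _ si Fi) (sumE _ _ sj Fj).
have [<-|ij] := eqVneq i j; first by have := Flip i u v; lra.
have -> : F i u - F j v = (F i u - F i v) + (F j u - F j v).
  by rewrite (Fj i)// (Fi j) 1?eq_sym// subr0 sub0r.
by apply: (le_trans (enormD _ _)); have := Flip i u v; have := Flip j u v; lra.
Qed.

Section Hard.
Context {R : realType} {n : nat}.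
Variables (x0 e : 'rV[R]_n) (ps : seq 'rV[R]_n) (r : R).

(** The constant makes the value at every centre zero, independently of [r]: the
    answer of the oracle has to be known before the centres are. *)
Definition hard (x : 'rV[R]_n) : R :=
  10^-1 * (bump 16^-1 ((x - x0) *m axis e) +
           \sum_(p <- ps) bump r ((x - p) *m coaxis e)
           + - (3 / 64 + 3 * r / 4)).

Definition hard_grad (x : 'rV[R]_n) : 'rV[R]_n :=
  10^-1 *: (bump_grad 16^-1 ((x - x0) *m axis e) *m axis e +
            \sum_(p <- ps) bump_grad r ((x - p) *m coaxis e) *m coaxis e).

Hypothesis e1 : dotv e e = 1.
Hypothesis r0 : 0 < r.
Hypothesis r16 : r <= 16^-1.
Hypothesis ps_uniq : uniq ps.
Hypothesis ps_orth : forall p, p \in ps -> dotv (p - x0) e = 0.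
Hypothesis ps_sep : forall p q, p \in ps -> q \in ps -> p != q ->
  8 * r <= dotv (p - q) (p - q).

Let s0 : (0 : R) < 16^-1. Proof. by rewrite invr_gt0. Qed.

Lemma hard_remainder : quad_remainder hard hard_grad.
Proof.
have h := quad_remainderZ 10^-1 (quad_remainderD (quad_remainderD
  (quad_remainder_affine x0 (tr_axis e)
     (fun v => axis_contraction v e1) (bump_remainder s0))
  (quad_remainder_sum ps (fun p => quad_remainder_affine p (tr_coaxis e)
     (fun v => coaxis_contraction v e1) (bump_remainder r0))))
  (quad_remainder_cst (- (3 / 64 + 3 * r / 4)))).
move=> x; have [C hC] := h x; exists C => v /hC.
by rewrite /hard_grad addr0.
Qed.

Lemma differentiable_hard x : differentiable hard x.
Proof. by have [] := quad_remainder_diff x hard_remainder. Qed.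

Lemma grad_hard : grad hard = hard_grad.
Proof. by apply/funext => x; have [] := quad_remainder_diff x hard_remainder. Qed.

(** Centres differ only orthogonally to [e], so their projections are as far
    apart as they are; the parallelogram inequality turns the separation [8 * r]
    into the bound, which forces one of the two bumps of index [p], [q] to
    vanish at [x]. *)
Lemma patches_apart p q x : p \in ps -> q \in ps -> p != q ->
  4 * r <= dotv ((x - p) *m coaxis e) ((x - p) *m coaxis e) +
           dotv ((x - q) *m coaxis e) ((x - q) *m coaxis e).
Proof.
move=> pp pq pNq; have := ps_sep pp pq pNq.
have pqE : p - q = (x - q) *m coaxis e - (x - p) *m coaxis e.
  have pq0 : dotv (p - q) e = 0.
    have -> : p - q = (p - x0) - (q - x0) by rewrite opprB addrA subrK.
    by rewrite dotvDl dotvNl !ps_orth// subrr.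
  rewrite -mulmxBl; have -> : x - q - (x - p) = p - q.
    by rewrite opprB addrC addrA subrK.
  by rewrite mul_coaxis pq0 scale0r subr0.
rewrite pqE.
set a := (x - q) *m _; set b := (x - p) *m _.
have := dotvv_ge0 (a + b); rewrite !dotvlin (dotvC b a).
by lra.
Qed.

Lemma hard_grad_lipschitz x y :
  enorm (hard_grad x - hard_grad y) <= 27 / 10 * enorm (x - y).
Proof.
rewrite /hard_grad -scalerBr enormZ ger0_norm ?invr_ge0//.
rewrite ler_pdivrMl// mulrA (mulrC 10) divfK ?pnatr_eq0//.
have lipM (s : R) p (M : 'M[R]_n) : 0 < s ->
    (forall v, dotv (v *m M) (v *m M) <= dotv v v) ->
    forall u v, enorm (bump_grad s ((u - p) *m M) *m M -
                 bump_grad s ((v - p) *m M) *m M) <= 9 * enorm (u - v).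
  move=> s_gt0 Mle u v; rewrite -mulmxBl.
  apply: (le_trans (enorm_contraction (Mle _))).
  apply: (le_trans (bump_grad_lipschitz _ _ s_gt0)).
  rewrite ler_wpM2l// -mulmxBl opprB addrA subrK.
  exact: enorm_contraction.
have h1 := lipM _ x0 _ s0 (fun v => axis_contraction v e1) x y.
have h2 := @disjoint_sum_lipschitz R n _ ps 9
  (fun p x => bump_grad r ((x - p) *m coaxis e) *m coaxis e) ps_uniq
  (ler0n _ _) (fun p => lipM _ p _ r0 (fun v => coaxis_contraction v e1)).
have {}h2 := h2 _ x y.
set a := bump_grad _ ((x - x0) *m _) *m _ in h1 *.
set a' := bump_grad _ ((y - x0) *m _) *m _ in h1 *.
set b := \sum_(p <- _) _; set b' := \sum_(p <- _) _.
have -> : a + b - (a' + b') = (a - a') + (b - b').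
  by rewrite opprD addrACA.
apply: (le_trans (enormD _ _)).
have {}h2 : enorm (b - b') <= 2 * 9 * enorm (x - y).
  apply: h2 => u p q pp pq pNq.
  have := patches_apart u pp pq pNq.
  have [h _|h] := leP (2 * r) (dotv ((u - p) *m coaxis e) ((u - p) *m coaxis e)).
    by left; rewrite bump_grad_far// mul0mx.
  by move=> h'; right; rewrite bump_grad_far ?mul0mx//; lra.
by lra.
Qed.

Lemma hard_ge x : - (3 / 320) <= hard x.
Proof.
rewrite /hard.
have := @bump_ge0 R n _ ((x - x0) *m axis e) s0.
have : 0 <= \sum_(p <- ps) bump r ((x - p) *m coaxis e).
  by apply: sumr_ge0 => p _; exact: bump_ge0.
set S := \sum_(p <- ps) _; set b := bump _ _ => S0 b0.
by have := r16; lra.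
Qed.

Lemma hard_at p : p \in ps -> hard p = 0.
Proof.
move=> pp; rewrite /hard mul_axis ps_orth// scale0r bump_near//; last first.
  by rewrite dotv0l invr_ge0.
rewrite (bigD1_seq p)//= big1_seq.
  rewrite subrr mul0mx bump_near ?dotv0l ?(ltW r0)//.
  by field.
move=> q /andP[qp pq]; have := patches_apart p pq pp qp.
rewrite subrr mul0mx dotv0l addr0 => h; by apply: bump_far => //; have := r0; lra.
Qed.

Lemma hard_grad_near p x : p \in ps -> dotv (x - p) (x - p) <= r ->
  hard_grad x = - 10^-1 *: (x - p).
Proof.
move=> pp xr; rewrite /hard_grad.
have -> : (x - x0) *m axis e = (x - p) *m axis e.
  rewrite !mul_axis; congr (_ *: _).
  have -> : x - x0 = (x - p) + (p - x0) by rewrite addrA subrK.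
  by rewrite dotvDl ps_orth// addr0.
have xa := axis_contraction (x - p) e1.
have xc := coaxis_contraction (x - p) e1.
rewrite bump_grad_near//; last by rewrite (le_trans xa)// (le_trans xr).
rewrite (bigD1_seq p)//= big1_seq; last first.
  move=> q /andP[qp pq]; have := patches_apart x pq pp qp => h.
  by rewrite bump_grad_far ?mul0mx//; have := r0; lra.
rewrite bump_grad_near ?(le_trans xc)// addr0 !mulNmx.
by rewrite mul_axis_axis// mul_coaxis_coaxis// -opprD axis_coaxis scalerN scaleNr.
Qed.

(** The patches have gradients orthogonal to [e] and disappear from the slope
    along [e]. *)
Lemma hard_grad_axis x : `|dotv (x - x0) e| <= 4^-1 ->
  dotv (hard_grad x) e = - 10^-1 * dotv (x - x0) e.
Proof.
move=> xe.
have eco (v : 'rV[R]_n) : dotv (v *m coaxis e) e = 0.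
  by rewrite dotv_mulmx tr_coaxis mul_coaxis e1 scale1r subrr dotvC dotv0l.
rewrite /hard_grad dotvZl dotvDl dotv_suml big1 => [|p _]; last exact: eco.
rewrite addr0 bump_grad_near//; last first.
  rewrite mul_axis dotvZl dotvZr e1 mulr1 -expr2 -real_normK ?num_real//.
  have -> : 16^-1 = 4^-1 ^+ 2 :> R by rewrite exprVn -natrX.
  by rewrite lerXn2r ?nnegrE.
rewrite mulNmx dotvNl mul_axis_axis// mul_axis dotvZl e1 mulr1.
by rewrite mulrN mulNr.
Qed.

End Hard.

(** * Second-order behaviour of the hard function *)

Section Hessian.
Context {R : realType} {n : nat}.
Implicit Types (f : 'rV[R]_n -> R) (x y p e : 'rV[R]_n).

Lemma continuous_dotvv : continuous (fun x : 'rV[R]_n => dotv x x).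
Proof.
apply: (continuous_big (@add_continuous R)) => i _ x.
by apply: (@cvgM _ _ (nbhs x)); exact: (@coord_continuous R 1 n 0 i x).
Qed.

Lemma near_open_ball p y (r : R) : dotv (y - p) (y - p) < r ->
  \forall z \near y, dotv (z - p) (z - p) < r.
Proof.
move=> yr.
have : {for y, continuous ((fun x => dotv x x) \o (fun z => z - p))}.
  apply: continuous_comp; last exact: continuous_dotvv.
  by apply: (@cvgB R 'rV[R]_n 'rV[R]_n (nbhs y) _ id (cst p) y p);
    [exact: cvg_id|exact: cvg_cst].
by move=> /cvgr_lt; apply.
Qed.

Lemma diff_affine_near (V : normedModType R) (g : V -> V) (y p : V) (c : R) :
  (\forall z \near y, g z = c *: (z - p)) ->
  differentiable g y /\ 'd g y = c \*: idfun :> (V -> V).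
Proof.
move=> gy; apply: diff_littleo => [|e e0].
  by move=> x; apply: cvgZl_tmp; exact: cvg_id.
near=> h.
have -> : g (h + y) = c *: (h + y - p).
  near: h; have := gy; rewrite (near_shift 0 y) subr0.
  by apply: filterS => z.
rewrite (nbhs_singleton gy) /= -!scalerBr.
by rewrite opprB addrA subrK addrK subrr scaler0 normr0 mulr_ge0// ltW.
Unshelve. all: by end_near. Qed.

Lemma hess_affine f p y (c : R) :
  (\forall z \near y, grad f z = c *: (z - p)) ->
  differentiable (grad f) y /\ hess f y = c%:M.
Proof.
move=> /diff_affine_near[df dfE]; split => //.
rewrite /hess /jacobian; apply/matrixP => i j.
by rewrite mxE dfE /= !mxE /= eq_sym mulr_natr.
Qed.

End Hessian.

Section Curvature.
Context {R : realType} {n : nat}.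
Implicit Types (f : 'rV[R]_n -> R) (x y p e : 'rV[R]_n) (c : R).

(** The gradient may be far from affine at [y]; only its component along [e] has
    to be, and the difference quotient of that component along [e] is constant. *)
Lemma hess_curvature f p e y c : dotv e e = 1 ->
  (\forall z \near y, dotv (grad f z) e = c * dotv (z - p) e) ->
  differentiable (grad f) y -> dotv (e *m hess f y) e = c.
Proof.
move=> e1 fe df; rewrite /hess -deriveEjacobian//.
have : h^-1 *: (grad f (h *: e + y) - grad f y) @[h --> 0^'] -->
    'D_e (grad f) y by have := diff_derivable (v := e) df.
move=> /(continuous_cvg _ (@continuous_dotvr R n e _)) Dl.
apply: (norm_cvg_unique Dl); apply: cvg_near_cst.
have near_line : \forall h \near 0^',
    dotv (grad f (h *: e + y)) e = c * dotv (h *: e + y - p) e.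
  have lin : h *: e + y @[h --> (0 : R)^'] --> y.
    rewrite -[X in _ --> X]add0r -(scale0r e); apply: cvgD; last exact: cvg_cst.
    by apply: cvgZr_tmp; exact: nbhs_dnbhs.
  exact: lin fe.
near=> h.
have h0 : h != 0 by near: h; exact: nbhs_dnbhs_neq.
rewrite /= dotvZl dotvDl dotvNl (nbhs_singleton fe).
have -> : dotv (grad f (h *: e + y)) e = c * dotv (h *: e + y - p) e.
  by near: h.
rewrite -(addrA _ y) [dotv (h *: e + _) e]dotvDl dotvZl e1.
by field.
Unshelve. all: by end_near. Qed.

Lemma convex_set_eq (V : lmodType R) (phi : V -> R) c :
  (forall (a b : R) u v, phi (a *: u + b *: v) = a * phi u + b * phi v) ->
  convex_set ([set u | phi u = c] : set (convex_lmodType V)).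
Proof.
move=> phil u v l; rewrite !inE /= => uc vc.
rewrite /conv /=.
rewrite phil uc vc.
by rewrite -mulrDl addrC subrK mul1r.
Qed.

(** [A |-> <e, A e>] is continuous and affine, so a value it takes at all Hessians
    near [x] passes to limits of Hessians and to their convex hull. *)
Lemma clarke_curvature f e x c A :
  (\forall z \near x, twice_differentiable f z -> dotv (e *m hess f z) e = c) ->
  clarke_hessian f x A -> dotv (e *m A) e = c.
Proof.
move=> fx fA; apply: (fA [set B : 'M[R]_n | dotv (e *m B) e = c]); split.
  apply: (convex_set_eq (phi := fun A : 'M[R]_n => dotv (e *m A) e)).
  by move=> a b u v; rewrite mulmxDr -!scalemxAr dotvDl !dotvZl.
move=> B [y [fy yx yB]] /=.
have {}yB := continuous_cvg _ (@continuous_quadform R n e _) yB.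
apply: (norm_cvg_unique (yB _)); apply: cvg_near_cst.
exact: (filterS (fun j fyj => fyj (fy j)) (yx _ fx)).
Qed.

Lemma stationarity_le f x e (r c : R) : dotv e e = 1 ->
  (forall y A, enorm (y - x) <= r -> clarke_hessian f y A ->
     dotv (e *m A) e = c) -> 0 <= r ->
  (stationarity r f x <= c%:E)%E.
Proof.
move=> e1 fc r0; apply: (@le_trans _ _ (ereal_sup [set (dotv z e)%:E | z in
      convex_hull (\bigcup_(y in [set x + r *: u | u in @euclidean_ball R n])
              clarke_hessian_at f y e)])).
  by apply: ereal_inf_lbound; exists e => //; rewrite /euclidean_sphere/= /enorm e1 sqrtr1.
apply: ge_ereal_sup => _ [z zU <-]; rewrite lee_fin le_eqVlt; apply/orP; left.
apply/eqP; apply: (zU [set z : 'rV[R]_n | dotv z e = c]); split.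
  apply: (convex_set_eq (phi := fun z : 'rV[R]_n => dotv z e)).
  by move=> a b u v; rewrite dotvDl !dotvZl.
move=> _ [_ [u u1 <-] [A fA <-]] /=; apply: fc fA.
by rewrite addrC addKr enormZ ger0_norm// ler_piMr.
Qed.

End Curvature.

(** * The hard function in the function class *)

Section HardClass.
Context {R : realType} {n : nat}.
Variables (x0 e : 'rV[R]_n) (ps : seq 'rV[R]_n) (r : R).
Hypothesis e1 : dotv e e = 1.
Hypothesis r0 : 0 < r.
Hypothesis r16 : r <= 16^-1.
Hypothesis ps_uniq : uniq ps.
Hypothesis ps_orth : forall p, p \in ps -> dotv (p - x0) e = 0.
Hypothesis ps_sep : forall p q, p \in ps -> q \in ps -> p != q ->
  8 * r <= dotv (p - q) (p - q).

Let f := hard x0 e ps r.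

Let gradE : grad f = hard_grad x0 e ps r.
Proof. exact: grad_hard. Qed.

Lemma hess_hard_near p y : p \in ps -> dotv (y - p) (y - p) < r ->
  differentiable (grad f) y /\ hess f y = (- 10^-1)%:M.
Proof.
move=> pp yp; apply: (@hess_affine _ _ f p); rewrite gradE.
apply: filterS (near_open_ball yp) => z /ltW zr.
exact: hard_grad_near.
Qed.

Lemma C2_hard p : p \in ps -> C2_around f p.
Proof.
move=> pp; have : dotv (p - p) (p - p) < r by rewrite subrr dotv0l.
move=> /near_open_ball; apply: filterS => y yp.
have [dy hy] := hess_hard_near pp yp; split.
  split => //; apply: filterE => z; exact: differentiable_hard.
suff : hess f @ y --> hess f y by [].
rewrite hy; apply: (@cvg_near_cst _ _ _ _ (nbhs y)).
exact: (filterS (fun z zp => (hess_hard_near pp zp).2) (near_open_ball yp)).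
Qed.

Lemma oracle_hard p : p \in ps ->
  oracle f p = (0, 0, insubd (symmx0 R n) (- 10^-1)%:M).
Proof.
move=> pp; have pp0 : dotv (p - p) (p - p) < r by rewrite subrr dotv0l.
have [_ hp] := hess_hard_near pp pp0.
rewrite /oracle hp gradE (hard_grad_near e1 r0 r16 ps_uniq ps_orth ps_sep pp (ltW pp0)).
by rewrite subrr scaler0 /f (hard_at r0 ps_uniq ps_orth ps_sep pp).
Qed.

Let near_slab y (c : R) : `|dotv (y - x0) e| < c ->
  \forall z \near y, `|dotv (z - x0) e| < c.
Proof.
have : {for y, continuous ((fun z => `|dotv z e|) \o (fun z => z - x0))}.
  apply: continuous_comp.
    by apply: (@cvgB R 'rV[R]_n 'rV[R]_n (nbhs y) _ id (cst x0) y x0);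
      [exact: cvg_id|exact: cvg_cst].
  apply: (@continuous_comp _ _ _ (fun z : 'rV[R]_n => dotv z e) Num.norm).
    exact: continuous_dotvr.
  exact: norm_continuous.
by move=> /cvgr_lt; apply.
Qed.

Lemma hard_curvature y : `|dotv (y - x0) e| < 4^-1 ->
  differentiable (grad f) y -> dotv (e *m hess f y) e = - 10^-1.
Proof.
move=> ye; apply: (@hess_curvature _ _ f x0) => //.
apply: filterS (near_slab ye) => z /ltW zlt.
by rewrite gradE; exact: hard_grad_axis.
Qed.

(** As [p - x0] is orthogonal to [e], the ball of radius 1/8 about [p] stays in
    the slab of half-width 1/4 about [x0], strictly inside, so that Hessians at
    points approaching the ball are covered too. *)
Lemma hard_stationarity p : p \in ps ->
  (stationarity (1 / 8) f p <= (- 10^-1)%:E)%E.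
Proof.
move=> pp; apply: (@stationarity_le _ _ f p e) => // y A yp.
apply: clarke_curvature.
have ye : `|dotv (y - x0) e| < 4^-1.
  have -> : y - x0 = (y - p) + (p - x0) by rewrite addrA subrK.
  rewrite dotvDl ps_orth// addr0.
  have := dotv_le_enorm (y - p) e; rewrite {2}/enorm e1 sqrtr1 mulr1.
  by lra.
apply: filterS (near_slab ye) => z ze [_ dz].
exact: hard_curvature.
Qed.

Lemma hard_gap : x0 \in ps ->
  ((f x0)%:E - ereal_inf [set (f x)%:E | x in setT] <= (17 / 256)%:E)%E.
Proof.
move=> x0ps; rewrite /f (hard_at r0 ps_uniq ps_orth ps_sep)// sub0e leeNl -EFinN.
apply/ereal_infP => _ [x _ <-]; rewrite lee_fin.
by have := hard_ge x0 e ps r0 r16 x; lra.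
Qed.

(** Continuity of the gradient follows from its Lipschitz bound; the factor
    [n + 1] passes from the Euclidean norm to the sup norm. *)
Lemma hard_C1 : C1_function f.
Proof.
split=> [x|]; first exact: differentiable_hard.
rewrite gradE => x; apply/(@cvgrPdist_lt R 'rV[R]_n _ (nbhs x)) => eps eps0.
have K0 : 0 < 27 / 10 * (n%:R + 1) :> R by rewrite mulr_gt0// ltr_wpDl.
near=> y.
have : `|x - y| < eps / (27 / 10 * (n%:R + 1)).
  near: y; apply: (@cvgr_dist_lt R 'rV[R]_n _ (nbhs x) _ id x).
    exact: cvg_id.
  by rewrite divr_gt0.
rewrite ltr_pdivlMr// => xy.
apply: (le_lt_trans (normr_le_enorm _)).
apply: (le_lt_trans (hard_grad_lipschitz e1 r0 ps_uniq ps_orth ps_sep x y)).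
apply: le_lt_trans xy; rewrite mulrCA ler_wpM2l// mulrC.
apply: enorm_le; first by rewrite mulr_ge0// ltW// ltr_wpDl.
rewrite (le_trans (dotvv_le_normr _))// exprMn ler_wpM2r ?sqr_ge0//.
by have := ler0n R n; rewrite expr2; nra.
Unshelve. all: by end_near. Qed.

Lemma hard_lipschitz x y :
  enorm (grad f x - grad f y) <= 4086 / 1000 * enorm (x - y).
Proof.
rewrite gradE (le_trans (hard_grad_lipschitz e1 r0 ps_uniq ps_orth ps_sep x y))//.
by rewrite ler_wpM2r ?enorm_ge0//; lra.
Qed.

End HardClass.

(** * Runs against a constant oracle *)

(** The run of an algorithm against an oracle that always answers [o], whether or
    not a function with these values exists. *)
Fixpoint blind_iterates {R : realType} {n m : nat} (A : det_algorithm R n m)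
    (o : R * 'rV[R]_n * symmx R n) (k : nat) :
    (k <= m)%N -> k.+1.-tuple 'rV[R]_n :=
  match k with
  | 0 => fun _ => [tuple start A]
  | j.+1 => fun jm =>
      let xs := blind_iterates A o (ltnW jm) in
      [tuple of rcons xs
        (@step R n m A (Ordinal jm) [tuple of [seq (x, o) | x <- xs]])]
  end.

Section Blind.
Context {R : realType} {n m : nat}.
Variables (A : det_algorithm R n m) (o : R * 'rV[R]_n * symmx R n).

Lemma start_blind k (km : (k <= m)%N) : start A \in blind_iterates A o km.
Proof.
elim: k km => [|k IH] km; first by rewrite inE.
by rewrite /= mem_rcons inE IH orbT.
Qed.

(** The function may be chosen after the run: it suffices that it gives the
    constant answer at the points of the blind run. *)
Lemma first_iterates_blind f k (km : (k <= m)%N) :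
  {in blind_iterates A o km, forall x, oracle f x = o} ->
  first_iterates A f km = blind_iterates A o km.
Proof.
elim: k km => [//|k IH] km fo /=.
have {}fo : {in blind_iterates A o (ltnW km), forall x, oracle f x = o}.
  by move=> x xb; apply: fo; rewrite /= mem_rcons inE xb orbT.
rewrite IH//; apply: val_inj => /=; congr (rcons _ (@step R n m A _ _)).
by apply: val_inj => /=; apply/eq_in_map => x /fo ->.
Qed.

End Blind.

(** A nonzero row vector in the kernel of the matrix whose columns are the
    vectors of [s], of rank less than [n]. *)
Lemma unit_orthogonal {R : realType} {n : nat} (s : seq 'rV[R]_n) :
  (size s < n)%N ->
  exists2 e : 'rV[R]_n, dotv e e = 1 & {in s, forall p, dotv p e = 0}.
Proof.
move=> sn; pose M : 'M[R]_(n, size s) := \matrix_(i, j) s`_j 0 i.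
have : kermx M != 0.
  rewrite -mxrank_eq0 mxrank_ker subn_eq0 -ltnNge.
  exact: leq_ltn_trans (rank_leq_col _) sn.
move=> /rowV0Pn[v /sub_kermxP vM v0].
have vv : 0 < dotv v v by rewrite lt_neqAle eq_sym dotvv_eq0 v0 dotvv_ge0.
exists ((enorm v)^-1 *: v).
  rewrite dotvZl dotvZr mulrA -expr2 exprVn enorm_sqr mulVf//.
  by rewrite gt_eqF.
move=> p ps; rewrite dotvZr; apply/eqP; rewrite mulf_eq0; apply/orP; right.
have ip : (index p s < size s)%N by rewrite index_mem.
have := congr1 (fun B : 'rV[R]_(size s) => B 0 (Ordinal ip)) vM.
rewrite !mxE => <-; apply/eqP; apply: eq_bigr => i _.
by rewrite !mxE /= nth_index// mulrC.
Qed.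

Lemma positive_lower_bound {R : realType} (I : eqType) (s : seq I) (F : I -> R) (b : R) :
  0 < b -> {in s, forall i, 0 < F i} ->
  exists r, [/\ 0 < r, r <= b & {in s, forall i, r <= F i}].
Proof.
move=> b0; elim: s => [|i s IH] Fs; first by exists b.
have [|r [r0 rb rF]] := IH; first by move=> j js; apply: Fs; rewrite inE js orbT.
have Fi : 0 < F i by apply: Fs; exact: mem_head.
exists (Num.min r (F i)); split; first by rewrite lt_min r0.
  by rewrite ge_min rb.
move=> j; rewrite inE => /predU1P[->|/rF rj]; first by rewrite ge_min lexx orbT.
by rewrite ge_min rj.
Qed.

Lemma separation_radius {R : realType} {n : nat} (ps : seq 'rV[R]_n) (b : R) : 0 < b ->
  exists r, [/\ 0 < r, r <= b & forall p q, p \in ps -> q \in ps -> p != q ->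
                  8 * r <= dotv (p - q) (p - q)].
Proof.
move=> b0.
pose s := [seq pq <- [seq (p, q) | p <- ps, q <- ps] | pq.1 != pq.2].
pose F (pq : 'rV[R]_n * 'rV[R]_n) := 8^-1 * dotv (pq.1 - pq.2) (pq.1 - pq.2).
have [|r [r0 rb rF]] := @positive_lower_bound R _ s F b b0.
  move=> [p q]; rewrite mem_filter => /andP[/= pq _].
  by rewrite /F mulr_gt0// lt_neqAle eq_sym dotvv_eq0 subr_eq0 pq dotvv_ge0.
exists r; split => // p q pp qp pq.
have /rF : (p, q) \in s by rewrite mem_filter pq/=; apply/allpairsP; exists (p, q).
by rewrite /F /= ler_pdivlMl.
Qed.

Theorem corollary3p2 (R : realType) :
  (ereal_sup [set v : \bar R |
      exists (m n : nat) (A : det_algorithm R n m),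
        [/\ (1 <= m)%N, (m + 3 <= n)%N &
          v = ereal_inf [set
                \big[maxe/-oo]_(k < m.+1)
                   stationarity (1 / 8) f (iterates A f k)
                | f in F_C1 (4086 / 1000) (17 / 256) A]]]
   <= (- ((92 * 1000 + 714) / 10 ^+ 7))%:E)%E.
Proof.
apply: ge_ereal_sup => _ [m [n [A [_ mn ->]]]].
pose o : R * 'rV[R]_n * symmx R n := (0, 0, insubd (symmx0 R n) (- 10^-1)%:M).
pose xs := blind_iterates A o (leqnn m).
pose ps := undup xs; pose x0 := start A.
have mem_ps p : (p \in ps) = (p \in xs) by rewrite mem_undup.
have [|e e1 ps_orth] := @unit_orthogonal R n [seq p - x0 | p <- ps].
  rewrite size_map (leq_ltn_trans (size_undup _))// size_tuple.
  by apply: leq_trans mn; rewrite addn3.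
have {}ps_orth p : p \in ps -> dotv (p - x0) e = 0.
  by move=> pp; apply: ps_orth; exact: map_f.
have [|r [r0 r16 ps_sep]] := @separation_radius R n ps 16^-1; first by rewrite invr_gt0.
have ps_uniq : uniq ps := undup_uniq _.
pose f := hard x0 e ps r.
have fE : first_iterates A f (leqnn m) = xs.
  apply: first_iterates_blind => x xxs; apply: oracle_hard => //.
  by rewrite mem_ps.
have it_ps k : iterates A f k \in ps by rewrite mem_ps /iterates fE mem_tnth.
have x0ps : x0 \in ps by rewrite mem_ps start_blind.
have fF : F_C1 (4086 / 1000) (17 / 256) A f.
  split.
  - exact: hard_C1.
  - exact: hard_lipschitz.
  - exact: hard_gap.
  - by move=> k; apply: C2_hard.
apply: (@le_trans _ _ (\big[maxe/-oo]_(k < m.+1)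
    stationarity (1 / 8) f (iterates A f k))%E).
  by apply: ereal_inf_lbound; exists f.
apply: (@le_trans _ _ (- 10^-1)%:E); last by rewrite lee_fin; lra.
apply: (big_ind (fun v => v <= (- 10^-1)%:E)%E).
- exact: leNye.
- by move=> u v u0 v0; rewrite ge_max u0.
- by move=> k _; apply: hard_stationarity.
Qed.
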